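(* Let $(P,\le)$ be a Borel poset such that the collection $\mathcal{C}$ of finite centred subsets of $P$ is a Borel subset of $[P]^{<\omega}$, and such that there is a Borel function $f:\mathcal{C}\to P$ with $f(C)\le p$ for every $C\in\mathcal{C}$ and every $p\in C$. Then exactly one of the following holds: (1) $P$ is Borel $\sigma$-linked; (2) there are a subset $P'\subseteq P(G_0)$ which is not Borel $\sigma$-linked and a Borel map $\phi:P'\to P$ preserving incompatibility, i.e. whenever $p,q\in P'$ are incompatible then $\phi(p),\phi(q)$ are incompatible in $P$.
   Context: A Borel poset is a partial order $(P,\le)$ on a Polish (or standard Borel) space with $\le$ Borel in $P^2$. Elements $x,y$ are compatible if they have a common lower bound, incompatible otherwise; a set is linked if its elements are pairwise compatible and centred if every finite subset has a common lower bound. $P$ is Borel $\sigma$-linked if it is a union of countably many Borel linked subsets. $[P]^{<\omega}$ is the standard Borel space of finite subsets of $P$. Let $T_2=2^{<\omega}$ and fix $D_2\subseteq T_2$ dense (every node has an extension in $D_2$) and containing exactly one node of each length. $G_0$ is the graph on $2^\omega$ whose edges are the pairs $\{d^\frown 0^\frown x, d^\frown 1^\frown x\}$ for $d\in D_2$, $x\in 2^\omega$. $P(G_0)$ is the Borel poset of finite subsets of $2^\omega$ containing no edge of $G_0$, ordered by reverse inclusion; $P'$ is considered with the order (and compatibility) of $P(G_0)$. *)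

(* Defs.v *)
From HB Require Import structures.
From mathcomp Require Import all_boot all_order all_algebra finmap.
From mathcomp Require Import all_classical all_reals all_analysis.

Set Implicit Arguments.
Unset Strict Implicit.
Unset Printing Implicit Defensive.

Local Open Scope classical_set_scope.

(* The Borel structures below are plain set systems rather than               *)
(* measurableType instances, because measurableType requires a point, whereas *)
(* a poset, or a subset of one, may be empty.                                 *)

Definition borel (T : topologicalType) : set (set T) := <<s @open T >>.
Arguments borel : clear implicits.

Definition sub_borel (X : Type) (S : set (set X)) (A : set X) : set (set A) :=
  preimage_set_system setT (@set_val X A) S.
Arguments sub_borel {X} S A.

(* The hypothesis of measurable_fun D f that D be measurable is unwanted here:*)
(* a map on an arbitrary subset A is a function on the type A, and is Borel   *)
(* with respect to sub_borel.                                                 *)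
Definition borel_map (X Y : Type) (SX : set (set X)) (SY : set (set Y))
    (f : X -> Y) : Prop :=
  forall B : set Y, SY B -> SX (f @^-1` B).

Definition completely_metrizable (T : topologicalType) : Prop :=
  exists (R : realType) (M : metricType R) (h : T -> M),
    [/\ bijective h,
        forall U : set M, open U <-> open (h @^-1` U) &
        forall F : set_system M, ProperFilter F -> cauchy F ->
          exists x : M, F --> x].

Definition polish (T : topologicalType) : Prop :=
  (exists2 D : set T, countable D & dense D) /\ completely_metrizable T.

(* The Borel structure of [T]^{<omega}, generated by the sets of all F that   *)
(* meet B, for B Borel in T. On finite subsets of a Polish space this is the  *)
(* Effros structure (generated by open B alone), and also the quotient        *)
(* structure (S is Borel iff, for every n, the set of the n-tuples whose      *)
(* range is in S is Borel).                                                   *)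
Definition fset_borel (T : topologicalType) : set (set {fset T}) :=
  <<s [set [set F : {fset T} | exists2 x, x \in F & B x] | B in borel T] >>.
Arguments fset_borel : clear implicits.

Section Posets.
Variables (X : choiceType) (le : rel X).

Definition compatible (x y : X) : Prop := exists z, le z x /\ le z y.

Definition linked (A : set X) : Prop :=
  forall x y, A x -> A y -> compatible x y.

Definition centred (A : set X) : Prop :=
  forall F : {fset X}, [set` F] `<=` A ->
    exists z, forall x, x \in F -> le z x.

Definition centred_fsets : set {fset X} :=
  [set C : {fset X} | centred [set` C]].

(* Compatibility is that of the whole of X, and Borel means relatively Borel  *)
(* in A: A itself need not be Borel.                                          *)
Definition borel_sigma_linked (S : set (set X)) (A : set X) : Prop :=
  exists L : nat -> set X,
    [/\ forall n, strace S A (L n),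
        forall n, linked (L n) &
        \bigcup_n L n = A].

End Posets.

Record borel_poset (P : topologicalType) (le : rel P) : Prop := BorelPoset {
  borel_poset_polish : polish P;
  borel_poset_refl : reflexive le;
  borel_poset_anti : antisymmetric le;
  borel_poset_trans : transitive le;
  borel_poset_borel : borel (P * P)%type [set xy | le xy.1 xy.2]
}.

(* The concatenation of the finite word s and the infinite word x.            *)
Definition word_cat (s : seq bool) (x : cantor_space) : cantor_space :=
  fun n => nth (x (n - size s)%N) s n.

Definition dense_nodes (D : set (seq bool)) : Prop :=
  forall s, exists2 t, D t & prefix s t.

Definition one_node_per_length (D : set (seq bool)) : Prop :=
  forall n : nat, exists! s, D s /\ size s = n.

Definition G0 (D : set (seq bool)) (x y : cantor_space) : Prop :=
  exists2 d, D d & exists z : cantor_space,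
    (x = word_cat (rcons d false) z /\ y = word_cat (rcons d true) z) \/
    (x = word_cat (rcons d true) z /\ y = word_cat (rcons d false) z).

Definition G0_free (D : set (seq bool)) : set {fset cantor_space} :=
  [set F : {fset cantor_space} |
    forall x y, x \in F -> y \in F -> ~ G0 D x y].

Definition PG0 (D : set (seq bool)) : choiceType := set_type (G0_free D).

Definition PG0_le (D : set (seq bool)) : rel (PG0 D) :=
  fun p q => (set_val q `<=` set_val p)%fset.

Definition PG0_borel (D : set (seq bool)) : set (set (PG0 D)) :=
  sub_borel (fset_borel cantor_space) (G0_free D).
Arguments PG0_le : clear implicits.
Arguments PG0_borel : clear implicits.

(* Main.v *)
Require Import Defs.
From HB Require Import structures.
From mathcomp Require Import all_boot all_order all_algebra finmap.
From mathcomp Require Import all_classical all_reals all_analysis.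
From mathcomp Require Import lra.
(* finmap shadows pickle and unpickle. *)
From mathcomp Require Import choice.

Set Implicit Arguments.
Unset Strict Implicit.
Unset Printing Implicit Defensive.

Import Order.TTheory GRing.Theory Num.Theory.
Local Open Scope classical_set_scope.

(* Incompatibility is a Borel graph on P, because x and y are compatible iff  *)
(* {x, y} is centred, and its Borel independent sets are the Borel linked     *)
(* sets. By the G0 dichotomy of Kechris, Solecki and Todorcevic, either P is  *)
(* covered by countably many Borel linked sets, or there is a Borel map h     *)
(* from the Cantor space to P sending the edges of G0 to incompatible pairs.  *)
(* In the second case it is enough to take for P' the set of the singletons   *)
(* {x}, and phi {x} = h x: {x} and {y} are incompatible in P(G0) iff xy is an *)
(* edge, so P' is not Borel sigma-linked since G0 has no countable Borel      *)
(* colouring, by Baire category. Pulling back the linked sets along phi shows *)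
(* that the two cases exclude each other.                                     *)
(*                                                                            *)
(* The dichotomy is proved by Bernshteyn's argument. The finite restrictions  *)
(* of G0 are obtained by joining two copies of the previous one by an edge; a *)
(* set of homomorphisms from such a restriction to the incompatibility graph  *)
(* is large if it is not covered by countably many sets whose values at some  *)
(* vertex lie in a Borel independent set. Largeness is preserved by joining   *)
(* two copies and by fixing finitely many digits, and the limit of a          *)
(* shrinking sequence of large sets is the required map.                      *)

(** * Analytic sets and separation *)

(** The descriptive set theory takes place on sequences of naturals: [polish_Baire_image] makes a
    nonempty [P] a continuous image of the Baire space, and incompatibility pulls back to an
    analytic relation ([incompatible_analytic]). In [G0_dichotomy], largeness survives fixing digits
    by countable additivity ([large_localize]), and survives joining two copies ([amalgam_large])
    because an analytic independent set lies in a Borel one ([analytic_independent_borel], by two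
    uses of Lusin separation); closedness carries the edges to the limit ([amalgam_limit]). That the
    singletons are not Borel sigma-linked rests on [baire_cover_G0], and
    [borel_sigma_linked_G0_exclusive] gives exclusivity. *)

Lemma sigma_generated_preimage (X Y : Type) (g : X -> Y) (Q : set (set X))
    (G : set (set Y)) :
  sigma_algebra setT Q -> (forall B, G B -> Q (g @^-1` B)) ->
  forall B, <<s G >> B -> Q (g @^-1` B).
Proof.
move=> [Q0 QC QU] GQ B; apply: (@smallest_sub _ _ _ [set B | Q (g @^-1` B)]) => //.
split => /=; first by rewrite preimage_set0.
- move=> A QA; rewrite setTD preimage_setC -setTD; exact: QC.
- by move=> A QA; rewrite preimage_bigcup; exact: QU.
Qed.

Lemma sigma_generatedC (Y : Type) (G : set (set Y)) (A : set Y) :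
  <<s G >> A -> <<s G >> (~` A).
Proof. by rewrite -setTD; exact: sigma_algebraCD. Qed.

Lemma sigma_generatedT (Y : Type) (G : set (set Y)) : <<s G >> [set: Y].
Proof. by have := sigma_generatedC (@sigma_algebra0 _ setT G); rewrite setC0. Qed.

Lemma sigma_generated_bigcap (Y : Type) (G : set (set Y)) (A : nat -> set Y) :
  (forall n, <<s G >> (A n)) -> <<s G >> (\bigcap_n A n).
Proof.
move=> GA; have -> : \bigcap_n A n = ~` \bigcup_n ~` A n.
  by rewrite setC_bigcup; apply: eq_bigcapr => n _; rewrite setCK.
apply: sigma_generatedC; apply: sigma_algebra_bigcup => n.
exact: sigma_generatedC.
Qed.

Lemma sigma_generatedI (Y : Type) (G : set (set Y)) (A B : set Y) :
  <<s G >> A -> <<s G >> B -> <<s G >> (A `&` B).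
Proof.
move=> GA GB; rewrite -bigcap2E; apply: sigma_generated_bigcap => -[|[|n]] //=.
exact: sigma_generatedT.
Qed.

(* These refer to the product of the discrete topologies on J -> nat, whose   *)
(* basic neighbourhoods fix finitely many coordinates. For J countably        *)
(* infinite this is a copy of the Baire space.                                *)
Definition fin_closed (J : eqType) (R : set (J -> nat)) : Prop :=
  forall z, ~ R z -> exists l : seq J, forall z', {in l, z =1 z'} -> ~ R z'.

Definition fin_continuous (J : eqType) (T : topologicalType)
    (g : (J -> nat) -> T) : Prop :=
  forall z U, open U -> U (g z) ->
    exists l : seq J, forall z', {in l, z =1 z'} -> U (g z').

Definition pair_point (J K : Type) (z : J -> nat) (c : K -> nat) :
    J + K -> nat :=
  fun i => match i with inl j => z j | inr k => c k end.

Definition analytic (J : eqType) (A : set (J -> nat)) : Prop :=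
  exists R : set ((J + nat)%type -> nat),
    fin_closed R /\ forall z, A z <-> exists c, R (pair_point z c).

Lemma fin_closed_reindex (J K : eqType) (e : J -> K) (R : set (J -> nat)) :
  fin_closed R -> fin_closed [set z : K -> nat | R (z \o e)].
Proof.
move=> cR z /= /cR [l lP]; exists (map e l) => z' zz'; apply: lP => j jl /=.
by apply: zz'; exact: map_f.
Qed.

Lemma fin_closed_bigcap (J : eqType) (I : Type) (R : I -> set (J -> nat)) :
  (forall i, fin_closed (R i)) -> fin_closed [set z | forall i, R i z].
Proof.
move=> cR z /= /existsNP[i /cR[l lP]]; exists l => z' /lP nR /(_ i) //.
Qed.

Lemma fin_closedI (J : eqType) (R S : set (J -> nat)) :
  fin_closed R -> fin_closed S -> fin_closed (R `&` S).
Proof.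
move=> cR cS z /not_andP[/cR|/cS] [l lP]; exists l => z' /lP nz' [] //.
Qed.

Lemma fin_closed_map (J : eqType) (l : seq J) (v : seq nat) :
  fin_closed [set z : J -> nat | map z l = v].
Proof.
move=> z /= zv; exists l => z' zz' z'v; apply: zv; rewrite -z'v.
by apply/eq_in_map => j jl; exact: zz'.
Qed.

Lemma fin_continuous_reindex (J K : eqType) (T : topologicalType) (e : J -> K)
    (g : (J -> nat) -> T) :
  fin_continuous g -> fin_continuous (fun z : K -> nat => g (z \o e)).
Proof.
move=> cg z U oU /(cg _ _ oU) [l lP]; exists (map e l) => z' zz'.
by apply: lP => j jl /=; apply: zz'; exact: map_f.
Qed.

Lemma analytic_reindex (J K : eqType) (e : J -> K) (A : set (J -> nat)) :
  analytic A -> analytic [set z : K -> nat | A (z \o e)].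
Proof.
move=> [R [cR AR]].
pose e' (i : (J + nat)%type) : (K + nat)%type :=
  match i with inl j => inl (e j) | inr n => inr n end.
have E z c : pair_point z c \o e' = pair_point (z \o e) c.
  by apply/funext => -[].
exists [set w : (K + nat)%type -> nat | R (w \o e')]; split.
  exact: fin_closed_reindex.
by move=> z /=; rewrite AR; split=> -[c Rc]; exists c; move: Rc; rewrite /= E.
Qed.

Lemma analytic_closed (J : eqType) (A : set (J -> nat)) :
  fin_closed A -> analytic A.
Proof.
move=> cA; exists [set w : (J + nat)%type -> nat | A (w \o inl)]; split.
  exact: fin_closed_reindex.
move=> z; split => [Az|[c]]; last by [].
by exists (fun=> 0%N).
Qed.

(** The first entry of the witness codes a finite list of coordinates whose values already force
    membership in [A]; this condition is closed. *)
Lemma analytic_open (J : countType) (A : set (J -> nat)) :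
  fin_closed (~` A) -> analytic A.
Proof.
move=> cA.
pose R : set ((J + nat)%type -> nat) :=
  [set w | exists2 l : seq J, unpickle (w (inr 0%N)) = Some l &
   forall z', {in l, w \o inl =1 z'} -> A z'].
exists R; split.
  move=> w Rw.
  case E : (unpickle (w (inr 0%N))) => [l|]; last first.
    by exists [:: inr 0%N] => w' ww' [l]; rewrite -ww' ?mem_head// E.
  exists (inr 0%N :: map inl l) => w' ww' [l' + lP].
  rewrite -ww' ?mem_head// E => -[ll']; apply: Rw; exists l => // z' wz'.
  apply: lP; rewrite -ll' => j jl /=; rewrite -wz'//= ww'//.
  by rewrite inE map_f ?orbT.
move=> z; split => [Az|[c [l /= _]]]; last by apply.
have [|l lP] := cA z; first by move=> /(_ Az).
exists (fun=> pickle l); exists l; first by rewrite pickleK.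
by move=> z' /lP /contrapT.
Qed.

(** A single witness stores the witnesses for all [i], entry [n] of the one for [i] at position
    [pickle (i, n)]. *)
Lemma analytic_bigcap (J : eqType) (I : countType) (A : I -> set (J -> nat)) :
  (forall i, analytic (A i)) -> analytic [set z | forall i, A i z].
Proof.
move=> /choice[R RP].
pose e (i : I) (j : (J + nat)%type) : (J + nat)%type :=
  match j with inl j => inl j | inr n => inr (pickle (i, n)) end.
exists [set w : (J + nat)%type -> nat | forall i, R i (w \o e i)]; split.
  by apply: fin_closed_bigcap => i; apply: fin_closed_reindex; case: (RP i).
move=> z /=; split => [Az|[c Rc] i].
  have /choice[c cP] : forall i, exists c, R i (pair_point z c).
    by move=> i; apply/(RP i).2.
  exists (fun m => if unpickle m is Some (i, n) then c i n else 0%N) => i.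
  have -> // : pair_point z (fun m => if unpickle m is Some (i, n) then c i n
      else 0%N) \o e i = pair_point z (c i).
  by apply/funext => -[//|n]/=; rewrite pickleK.
apply/(RP i).2; exists (fun n => c (pickle (i, n))).
have <- // : pair_point z c \o e i = pair_point z (fun n => c (pickle (i, n))).
by apply/funext => -[].
Qed.

Lemma analyticI (J : eqType) (A B : set (J -> nat)) :
  analytic A -> analytic B -> analytic (A `&` B).
Proof.
move=> aA aB.
have := @analytic_bigcap J bool (fun b => if b then A else B).
move=> /(_ (fun b => match b with true => aA | false => aB end)).
congr analytic; apply/seteqP; split => z /= => [zAB|[]].
  by split; [exact: (zAB true)|exact: (zAB false)].
by move=> ? ? [].
Qed.

(** The first entry of the witness names an index [n]; the rest is a witness for [A n]. *)
Lemma analytic_bigcup (J : eqType) (A : nat -> set (J -> nat)) :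
  (forall n, analytic (A n)) -> analytic (\bigcup_n A n).
Proof.
move=> /choice[R RP].
pose e (j : (J + nat)%type) : (J + nat)%type :=
  match j with inl j => inl j | inr n => inr n.+1 end.
exists [set w : (J + nat)%type -> nat | R (w (inr 0%N)) (w \o e)]; split.
  move=> w /= /(RP _).1[l lP]; exists (inr 0%N :: map e l) => w' ww'.
  rewrite -(ww' (inr 0%N)) ?mem_head//; apply: lP => j jl /=.
  by apply: ww'; rewrite inE map_f ?orbT.
move=> z /=; split => [[n _ /(RP n).2[c Rc]]|[c Rc]].
  exists (fun m => if m is k.+1 then c k else n) => /=.
  have -> // : pair_point z (fun m => if m is k.+1 then c k else n) \o e =
    pair_point z c by apply/funext => -[].
exists (c 0%N) => //; apply/(RP _).2; exists (c \o S).
have <- // : pair_point z c \o e = pair_point z (c \o S).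
by apply/funext => -[].
Qed.

Definition bianalytic (J : eqType) : set (set (J -> nat)) :=
  [set A | analytic A /\ analytic (~` A)].

Lemma bianalytic_sigma_algebra (J : countType) :
  sigma_algebra setT (@bianalytic J).
Proof.
have c0 : @fin_closed J set0 by move=> z _; exists [::] => z' _ [].
split.
- split; first exact: analytic_closed.
  by apply: analytic_open; rewrite setCK.
- by move=> A [aA aCA]; rewrite setTD; split => //; rewrite setCK.
- move=> A aA; split; first by apply: analytic_bigcup => n; case: (aA n).
  rewrite setC_bigcup.
  have -> : \bigcap_n ~` A n = [set z | forall n, (~` A n) z].
    by apply/seteqP; split => z /= h n; [exact: h|move=> _; exact: h].
  by apply: analytic_bigcap => n; case: (aA n).
Qed.

Lemma bianalytic_borel (J : countType) (T : topologicalType)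
    (g : (J -> nat) -> T) (B : set T) :
  fin_continuous g -> borel T B -> bianalytic (g @^-1` B).
Proof.
move=> cg; apply: sigma_generated_preimage; first exact: bianalytic_sigma_algebra.
move=> U oU.
have cU : fin_closed (~` (g @^-1` U)).
  move=> z /contrapT /(cg _ _ oU) [l lP]; exists l => z' /lP gz'; exact.
by split; [exact: analytic_open|exact: analytic_closed].
Qed.

Definition open_separated (T : topologicalType) : Prop :=
  forall x y : T, x <> y -> exists U V : set T,
    [/\ open U, open V, U x, V y & U `&` V = set0].

Definition borel_separated (T : topologicalType) (A B : set T) : Prop :=
  exists C, [/\ borel T C, A `<=` C & C `&` B = set0].

Lemma borel_separated_bigcup (T : topologicalType) (A B : nat -> set T) :
  (forall n m, borel_separated (A n) (B m)) ->
  borel_separated (\bigcup_n A n) (\bigcup_m B m).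
Proof.
move=> AB.
have /choice[C CP] : forall n, exists C, forall m,
    [/\ borel T (C m), A n `<=` C m & C m `&` B m = set0].
  by move=> n; have /choice[C CP] := AB n; exists C.
exists (\bigcup_n \bigcap_m C n m); split.
- apply: sigma_algebra_bigcup => n; apply: sigma_generated_bigcap => m.
  by case: (CP n m).
- by move=> x [n _ Anx]; exists n => // m _; case: (CP n m) => _ + _; apply.
- rewrite -subset0 => x [[n _ Cx] [m _ Bmx]].
  by case: (CP n m) => _ _ <-; split => //; exact: Cx.
Qed.

Lemma prefix_choice (X : Type) (Q : seq X -> Prop) :
  Q [::] -> (forall s, Q s -> exists x, Q (rcons s x)) ->
  exists a : nat -> X, forall n, Q (mkseq a n).
Proof.
move=> Q0 QS.
have [x0 _] := QS _ Q0.
have /choice[F FP] : forall s, exists x, Q s -> Q (rcons s x).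
  by move=> s; case: (pselect (Q s)) => [/QS[x ?]|?]; [exists x|exists x0].
pose st n := iter n (fun s => rcons s (F s)) [::].
exists (F \o st) => n.
have E : forall n, mkseq (F \o st) n = st n.
  by elim => [//|k IH]; rewrite mkseqS IH.
by rewrite E; elim: n => //= n IH; exact: FP.
Qed.

(** Position [i] of the word constrains the coordinate with code [i], if there is one, so that words
    of naturals serve for every countable [J]. *)
Definition cylinder (J : countType) (s : seq nat) : set (J -> nat) :=
  [set z | forall j, (pickle j < size s)%N -> z j = nth 0%N s (pickle j)].

Lemma cylinder_rcons (J : countType) (s : seq nat) :
  @cylinder J s = \bigcup_v cylinder (rcons s v).
Proof.
apply/seteqP; split => z /=.
  (* If [size s] codes no coordinate, the appended value constrains nothing and 0 will do. *)
  move=> zs; exists (if unpickle (size s) is Some j then z j else 0%N) => // j.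
  rewrite size_rcons ltnS leq_eqVlt nth_rcons => /orP[/eqP E|js].
    by rewrite E ltnn eqxx -E pickleK.
  by rewrite js zs.
move=> [v _ zs] j js; rewrite zs ?nth_rcons ?js// size_rcons.
exact: ltnW.
Qed.

Lemma pickle_bound (J : countType) (l : seq J) :
  exists n, {in l, forall j, (pickle j < n)%N}.
Proof.
exists (\max_(j <- l) pickle j).+1 => j jl.
by rewrite ltnS; apply: leq_bigmax_seq.
Qed.

Lemma cylinder_agree (J : countType) (a : nat -> nat) (l : seq J) :
  exists n0, forall n z, (n0 <= n)%N -> cylinder (mkseq a n) z ->
    {in l, a \o pickle =1 z}.
Proof.
have [n0 n0P] := pickle_bound l; exists n0 => n z n0n zn j jl /=.
have jn : (pickle j < n)%N by rewrite (leq_trans _ n0n)// n0P.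
by rewrite zn ?size_mkseq// nth_mkseq.
Qed.

(** Lusin separation. If the images cannot be separated, [borel_separated_bigcup] yields ever longer
    cylinders whose pieces cannot be separated either. The two branches lie in [R] and [S], since
    otherwise a piece would be empty; disjoint neighbourhoods of their images then separate the
    pieces at a late stage. *)
Lemma closed_separation (J K : countType) (T : topologicalType)
    (R : set (J -> nat)) (S : set (K -> nat))
    (g : (J -> nat) -> T) (h : (K -> nat) -> T) :
  open_separated T -> fin_closed R -> fin_closed S ->
  fin_continuous g -> fin_continuous h ->
  (forall a b, R a -> S b -> g a <> h b) ->
  borel_separated (g @` R) (h @` S).
Proof.
move=> sepT cR cS cg ch gh; apply: contrapT => nsep.
pose Q (s : seq (nat * nat)) := ~ borel_separated
  (g @` (R `&` cylinder (unzip1 s))) (h @` (S `&` cylinder (unzip2 s))).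
have [||a aP] := @prefix_choice _ Q.
- apply: contra_not nsep; rewrite /Q /=.
  suff E (I : countType) : @cylinder I [::] = setT by rewrite !E !setIT.
  by rewrite -subTset.
- move=> s Qs; apply: contrapT => /forallNP nQ; apply: Qs.
  rewrite (cylinder_rcons J) (cylinder_rcons K).
  rewrite !setI_bigcupr !image_bigcup; apply: borel_separated_bigcup => n m.
  by have /contrapT := nQ (n, m); rewrite /unzip1 /unzip2 !map_rcons.
pose a1 n := (a n).1; pose a2 n := (a n).2.
have {}aP n : ~ borel_separated (g @` (R `&` cylinder (mkseq a1 n)))
                        (h @` (S `&` cylinder (mkseq a2 n))).
  by have := aP n; rewrite /Q /unzip1 /unzip2 -!map_comp.
have Ra : R (a1 \o pickle).
  apply: contrapT => /cR[l lP]; have [n nP] := cylinder_agree a1 l.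
  apply: (aP n); exists set0; split; first exact: sigma_algebra0.
    by move=> x [z [Rz zn] _]; exact: lP (nP _ _ (leqnn n) zn) Rz.
  by rewrite set0I.
have Sa : S (a2 \o pickle).
  apply: contrapT => /cS[l lP]; have [n nP] := cylinder_agree a2 l.
  apply: (aP n); exists setT; split => //; first exact: sigma_generatedT.
  rewrite setTI -subset0.
  by move=> x [z [Sz zn] _]; exact: lP (nP _ _ (leqnn n) zn) Sz.
have [U [V [oU oV Ug Vh UV]]] := sepT _ _ (gh _ _ Ra Sa).
have [l lP] := cg _ _ oU Ug; have [m mP] := ch _ _ oV Vh.
have [n1 n1P] := cylinder_agree a1 l; have [n2 n2P] := cylinder_agree a2 m.
apply: (aP (maxn n1 n2)); exists U; split; first exact: sub_sigma_algebra.
- by move=> _ [z [_ zn] <-]; exact: lP (n1P _ _ (leq_maxl _ _) zn).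
- rewrite -subset0 => x [Uz [z [_ zn] hz]].
  by rewrite -UV; split => //; rewrite -hz; exact: mP (n2P _ _ (leq_maxr _ _) zn).
Qed.

Lemma analytic_separation (J K : countType) (T : topologicalType)
    (A : set (J -> nat)) (B : set (K -> nat))
    (g : (J -> nat) -> T) (h : (K -> nat) -> T) :
  open_separated T -> analytic A -> analytic B ->
  fin_continuous g -> fin_continuous h ->
  (forall a b, A a -> B b -> g a <> h b) ->
  borel_separated (g @` A) (h @` B).
Proof.
move=> sepT [R [cR AR]] [S [cS BS]] cg ch gh.
have -> : g @` A = (fun w : (J + nat)%type -> nat => g (w \o inl)) @` R.
  apply/seteqP; split => [_ [z /AR[c Rc] <-]|_ [w Rw <-]].
    by exists (pair_point z c).
  exists (w \o inl) => //; apply/AR; exists (w \o inr).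
  by have -> // : pair_point (w \o inl) (w \o inr) = w by apply/funext => -[].
have -> : h @` B = (fun w : (K + nat)%type -> nat => h (w \o inl)) @` S.
  apply/seteqP; split => [_ [z /BS[c Rc] <-]|_ [w Rw <-]].
    by exists (pair_point z c).
  exists (w \o inl) => //; apply/BS; exists (w \o inr).
  by have -> // : pair_point (w \o inl) (w \o inr) = w by apply/funext => -[].
apply: closed_separation => //; try exact: fin_continuous_reindex.
move=> a b Ra Sb; apply: gh.
  apply/AR; exists (a \o inr).
  by have -> // : pair_point (a \o inl) (a \o inr) = a by apply/funext => -[].
apply/BS; exists (b \o inr).
by have -> // : pair_point (b \o inl) (b \o inr) = b by apply/funext => -[].
Qed.

(** Analyticity of [E] is stated through pullbacks along continuous maps from sequences of naturals,
    the form in which separation uses it. *)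
Definition analytic_graph (T : topologicalType) (E : T -> T -> Prop) : Prop :=
  forall (J : countType) (g h : (J -> nat) -> T),
    fin_continuous g -> fin_continuous h -> analytic [set z | E (g z) (h z)].

Definition independent (T : Type) (E : T -> T -> Prop) (A : set T) : Prop :=
  forall x y, A x -> A y -> ~ E x y.

(* First reflection: separate A from the set of its neighbours by B0, then A  *)
(* from the set of the neighbours of B0 by B1; B0 `&` B1 is independent.      *)
Lemma analytic_independent_borel (T : topologicalType) (E : T -> T -> Prop)
    (p : (nat -> nat) -> T) (J : countType) (A : set (J -> nat))
    (g : (J -> nat) -> T) :
  open_separated T -> fin_continuous p -> (forall x, exists a, p a = x) ->
  analytic_graph E -> (forall x y, E x y -> E y x) ->
  analytic A -> fin_continuous g -> independent E (g @` A) ->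
  exists B, [/\ borel T B, g @` A `<=` B & independent E B].
Proof.
move=> sepT cp surjp aE symE aA cg indA.
have cpl (K : countType) : fin_continuous
  (fun z : (nat + K)%type -> nat => p (z \o inl)) by exact: fin_continuous_reindex.
have cpr (K : countType) : fin_continuous
  (fun z : (K + nat)%type -> nat => p (z \o inr)) by exact: fin_continuous_reindex.
have cgl : fin_continuous (fun z : (J + nat)%type -> nat => g (z \o inl)).
  exact: fin_continuous_reindex.
have [||B0 [bB0 AB0 B0N]] := @analytic_separation _ (J + nat)%type T A
  [set z : (J + nat)%type -> nat |
     A (z \o inl) /\ E (g (z \o inl)) (p (z \o inr))] g
  (fun z => p (z \o inr)) sepT aA _ cg (cpr _).
- by apply: analyticI; [exact: analytic_reindex|exact: aE cgl (cpr J)].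
- move=> a b Aa [Ab Eab] ab; apply: indA Eab; last by exists a.
  by exists (b \o inl).
have B0P x y : B0 x -> (g @` A) y -> ~ E x y.
  move=> B0x [z Az <-] Exy; have [b bx] := surjp x.
  suff : set0 x by []; rewrite -B0N; split => //.
  by exists (pair_point z b) => //; split => //=; rewrite bx; exact: symE.
have [||B1 [bB1 AB1 B1N]] := @analytic_separation _ (nat + nat)%type T A
  [set z : (nat + nat)%type -> nat |
     B0 (p (z \o inl)) /\ E (p (z \o inl)) (p (z \o inr))] g
  (fun z => p (z \o inr)) sepT aA _ cg (cpr _).
- apply: analyticI; last exact: aE (cpl nat) (cpr nat).
  by case: (bianalytic_borel (cpl nat) bB0).
- by move=> a b Aa [B0b Eb] ab; apply: B0P Eb => //; exists a.
exists (B0 `&` B1); split; first exact: sigma_generatedI.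
  by move=> x Ax; split; [exact: AB0|exact: AB1].
move=> x y [B0x _] [_ B1y] Exy.
have [a ax] := surjp x; have [b bx] := surjp y.
suff : set0 y by []; rewrite -B1N; split => //.
by exists (pair_point a b) => //=; rewrite /comp/= ax bx.
Qed.

(** * The G0 dichotomy *)

Lemma mkseq_word_cat (s : seq bool) (y : nat -> bool) j :
  mkseq (word_cat s y) (size s + j) = s ++ mkseq y j.
Proof.
apply: (@eq_from_nth _ false); first by rewrite size_cat !size_mkseq.
move=> i; rewrite size_mkseq => ij; rewrite nth_mkseq// nth_cat /word_cat.
case: ltnP => si; first exact: set_nth_default.
by rewrite nth_default// nth_mkseq// ltn_subLR.
Qed.

Section Dichotomy.
Variables (T : topologicalType) (E : T -> T -> Prop) (p : (nat -> nat) -> T).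
Hypotheses (sepT : open_separated T) (p_cont : fin_continuous p).
Hypothesis p_surj : forall x, exists a, p a = x.
Hypotheses (E_analytic : analytic_graph E) (E_sym : forall x y, E x y -> E y x).

Definition sigma_independent (A : set T) : Prop :=
  exists B : nat -> set T,
    (forall n, borel T (B n) /\ independent E (B n)) /\ A = \bigcup_n B n.

Lemma sigma_independent_borel (A : set T) : sigma_independent A -> borel T A.
Proof. by move=> [B [BP ->]]; apply: sigma_algebra_bigcup => n; case: (BP n). Qed.

Lemma sigma_independent_bigcup (I : countType) (A : I -> set T) :
  (forall i, sigma_independent (A i)) -> sigma_independent (\bigcup_i A i).
Proof.
move=> /choice[B BP].
exists (fun m => if unpickle m is Some (i, n) then B i n else set0); split.
  move=> m; case: (unpickle m) => [[i n]|]; first by case: (BP i).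
  by split; [exact: sigma_algebra0|move=> x y []].
apply/seteqP; split => [x [i _]|x [m _]].
  by case: (BP i) => _ -> [n _ Bx]; exists (pickle (i, n)) => //; rewrite pickleK.
case: (unpickle m) => [[i n] Bx|//]; exists i => //.
by case: (BP i) => _ ->; exists n.
Qed.

Lemma sigma_independentU (A B : set T) :
  sigma_independent A -> borel T B -> independent E B ->
  sigma_independent (A `|` B).
Proof.
move=> [C [CP ->]] bB iB; exists (fun n => if n is m.+1 then C m else B); split.
  by case.
apply/seteqP; split => [x [[n _ Cx]|Bx]|x [[|n] _ ?]]; last by left; exists n.
- by exists n.+1.
- by exists 0%N.
- by right.
Qed.

(* A point of this space codes a labelled copy of a finite piece of G0: the   *)
(* label of the vertex s is p of the point k |-> z (false, s, k), and         *)
(* k |-> z (true, t, k) codes a witness that the two ends of the edge         *)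
(* {d0t, d1t} have adjacent labels. At stage n only the words s of length n   *)
(* and t of length < n matter, and then d is the element of D2 of length      *)
(* n - 1 - size t.                                                            *)
Local Notation coord := (bool * seq bool * nat)%type.
Local Notation config := (coord -> nat).

Definition component (b : bool) (s : seq bool) (z : config) : nat -> nat :=
  fun k => z (b, s, k).

Definition label (s : seq bool) (z : config) : T := p (component false s z).

(** The last digit of a word tells the copy, so an edge between [d0t] and [d1t] keeps its form, with
    a longer [t], when copies are joined. *)
Definition half (i : bool) (z : config) : config :=
  fun j => z (j.1.1, rcons j.1.2 i, j.2).

Definition edge_code (s0 s1 t : seq bool) (z : config) :
    (nat + nat) + nat -> nat :=
  pair_point (pair_point (component false s0 z) (component false s1 z))
    (component true t z).

(** Adjacency of labels is only analytic; once a witness is part of the configuration, it becomes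
    the closed condition [W]. *)
Lemma edge_witness : exists W : set ((nat + nat) + nat -> nat), fin_closed W /\
  forall a b, E (p a) (p b) <-> exists c, W (pair_point (pair_point a b) c).
Proof.
have [||W [cW WP]] := @E_analytic (nat + nat)%type
  (fun z => p (z \o inl)) (fun z => p (z \o inr)).
- exact: fin_continuous_reindex.
- exact: fin_continuous_reindex.
- by exists W; split => // a b; rewrite -(WP (pair_point a b)).
Qed.

Variable W : set ((nat + nat) + nat -> nat).
Hypothesis W_closed : fin_closed W.
Hypothesis W_E :
  forall a b, E (p a) (p b) <-> exists c, W (pair_point (pair_point a b) c).

Definition amalgam (d : seq bool) (H : set config) : set config :=
  [set z | (forall i, H (half i z)) /\
           W (edge_code (rcons d false) (rcons d true) [::] z)].

Definition large (n : nat) (H : set config) : Prop :=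
  forall A, sigma_independent A ->
    exists z, H z /\ forall s, size s = n -> ~ A (label s z).

(** A right inverse of taking halves; the empty word belongs to neither half and is free to carry
    the witness [c] of the new edge. *)
Definition merge (z : bool -> config) (c : nat -> nat) : config :=
  fun j => match j.1.2 with
           | [::] => c j.2
           | x :: s => z (last x s) (j.1.1, belast x s, j.2)
           end.

Lemma component_merge (z : bool -> config) (c : nat -> nat) b s i :
  component b (rcons s i) (merge z c) = component b s (z i).
Proof.
apply/funext => k; rewrite /component /merge /=.
case E' : (rcons s i) => [|x s']; first by case: s E'.
have -> : last x s' = i by rewrite -(last_rcons x s i) E'.
by have := belast_rcons x s i; rewrite E' /= => -[->].
Qed.

Lemma half_merge (z : bool -> config) (c : nat -> nat) i :
  half i (merge z c) = z i.
Proof.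
apply/funext => -[[b s] k]; have := component_merge z c b s i.
by move=> /(congr1 (fun f => f k)).
Qed.

Lemma label_continuous s : fin_continuous (label s).
Proof.
exact: (@fin_continuous_reindex nat coord T (fun k => (false, s, k)) p).
Qed.

Lemma amalgam_closed d (H : set config) :
  fin_closed H -> fin_closed (amalgam d H).
Proof.
move=> cH; apply: fin_closedI.
  apply: fin_closed_bigcap => i.
  exact: (@fin_closed_reindex _ _ (fun j : coord => (j.1.1, rcons j.1.2 i, j.2))).
pose e (i : ((nat + nat) + nat)%type) : coord := match i with
  | inl (inl k) => (false, rcons d false, k)
  | inl (inr k) => (false, rcons d true, k)
  | inr k => (true, [::], k) end.
have := @fin_closed_reindex _ _ e W W_closed; congr fin_closed.
apply/seteqP; suff eE z : z \o e = edge_code (rcons d false) (rcons d true) [::] z.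
  by split => z /=; rewrite eE.
by apply/funext => -[[]|].
Qed.

(* If every point of the amalgam has a label in A, then no two points of the  *)
(* set H' of the z in H avoiding A can be joined by an edge at d, so the      *)
(* analytic set of the labels of d in H' is independent; enlarging A by a     *)
(* Borel independent superset of it contradicts the largeness of H.           *)
Lemma amalgam_large d (H : set config) :
  fin_closed H -> large (size d) H -> large (size d).+1 (amalgam d H).
Proof.
move=> cH lH A sA.
apply: contrapT => nA.
pose H' := H `&` [set z | forall s, size s = size d -> ~ A (label s z)].
have aH' : analytic H'.
  apply: analyticI; first exact: analytic_closed.
  apply: analytic_bigcap => s.
  have [sd|sd] := pselect (size s = size d); last first.
    have -> : (fun z => size s = size d -> ~ A (label s z)) = setT.
      by apply/seteqP; split.
    by apply: analytic_closed => z /(_ I).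
  have -> : (fun z => size s = size d -> ~ A (label s z)) =
      ~` (label s @^-1` A).
    by apply/seteqP; split => z /=; [exact|].
  have := bianalytic_borel (@label_continuous s) (sigma_independent_borel sA).
  by case.
have [|B [bB H'B iB]] := analytic_independent_borel sepT p_cont p_surj
  E_analytic E_sym aH' (@label_continuous d).
  move=> _ _ [z0 [Hz0 Az0] <-] [z1 [Hz1 Az1] <-] /W_E[c Wc].
  apply: nA; pose z b := if b then z1 else z0.
  exists (merge z c); split; first split.
  - by move=> i; rewrite half_merge; case: i.
  - by rewrite /edge_code !component_merge.
  - move=> s; case/lastP: s => [//|s i]; rewrite size_rcons => -[sd].
    by rewrite /label component_merge; case: i; [exact: Az1|exact: Az0].
have [z [Hz Az]] := lH _ (sigma_independentU sA bB iB).
apply: (Az d erefl); right; apply: H'B; exists z => //; split => // s sd As.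
by apply: (Az s sd); left.
Qed.

(** If every piece failed to be large, the union of the countably many exceptional sets would show
    that [H] is not large. *)
Lemma large_localize n (H : set config) (I : countType) (r : config -> I) :
  large n H -> exists v, large n (H `&` [set z | r z = v]).
Proof.
move=> lH; apply: contrapT => /forallNP nl.
have /choice[A AP] : forall v, exists A, sigma_independent A /\
   forall z, H z -> r z = v -> exists2 s, size s = n & A (label s z).
  move=> v; have /existsNP[A /not_implyP[sA nA]] := nl v; exists A; split => //.
  move=> z Hz zv; apply: contrapT => /forall2NP nz; apply: nA; exists z; split=> //.
  by move=> s sn; case: (nz s).
have [|z [Hz Az]] := lH (\bigcup_v A v).
  by apply: sigma_independent_bigcup => v; case: (AP v).
have [s sn As] := (AP (r z)).2 z Hz erefl.
by apply: Az sn _; exists (r z).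
Qed.

Definition level_coords (n : nat) : seq coord :=
  codom (fun q : bool * n.-bseq bool * 'I_n =>
    (q.1.1, bseqval q.1.2, nat_of_ord q.2)).

Lemma mem_level_coords n b s k :
  (size s <= n)%N -> (k < n)%N -> (b, s, k) \in level_coords n.
Proof.
by move=> sn kn; exact: (codom_f _ (b, Bseq sn, Ordinal kn)).
Qed.

Definition level_values (n : nat) (z : config) : seq nat :=
  map z (level_coords n).

(** Each stage amalgamates and then fixes the values on the finite list [level_coords]; both
    operations keep the set closed and large. *)
Lemma amalgam_sequence (d : nat -> seq bool) :
  (forall n, size (d n) = n) -> large 0 setT ->
  exists H : nat -> set config,
    [/\ forall n, H n !=set0,
        forall n, H n.+1 `<=` amalgam (d n) (H n) &
        forall n z z' b s k, H n z -> H n z' -> (size s <= n)%N -> (k < n)%N ->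
          z (b, s, k) = z' (b, s, k)].
Proof.
move=> dn l0.
pose Q (q : nat * set config) := fin_closed q.2 /\ large q.1 q.2.
have QS q : exists q' : nat * set config, Q q -> [/\ Q q', q'.1 = q.1.+1 &
    exists v, q'.2 = amalgam (d q.1) q.2 `&`
      [set z | level_values q.1.+1 z = v]].
  case: (pselect (Q q)) => [[cq lq]|]; last by exists q.
  have := @amalgam_large (d q.1) q.2 cq; rewrite dn => /(_ lq).
  move=> /(large_localize (level_values q.1.+1))[v lv].
  exists (q.1.+1, amalgam (d q.1) q.2 `&`
      [set z | level_values q.1.+1 z = v]) => _; split => //; last by exists v.
  by split => //=; apply: fin_closedI (@fin_closed_map _ _ _); exact: amalgam_closed.
have [F FP] := choice QS.
pose q n := iter n F (0%N, setT).
have Qq n : Q (q n) /\ (q n).1 = n.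
  elim: n => [|n [Qn n1]]; first by split => //; split => //= z /(_ I).
  by have [? -> _] := FP _ Qn; rewrite n1.
exists (fun n => (q n).2); split.
- move=> n; have [[_ lq] qn] := Qq n; rewrite qn in lq.
  (* A large set is nonempty, because the empty set is a countable union of Borel independent
     sets. *)
  have [|z [Hz _]] := lq set0; last by exists z.
  exists (fun=> set0); split; last by rewrite bigcup0.
  by move=> _; split; [exact: sigma_algebra0|move=> x y []].
- move=> n; have [Qn qn] := Qq n; have [_ _ [v]] := FP _ Qn.
  by rewrite qn /q iterS => -> z [].
- case=> [//|n] z z' b s k; have [Qn qn] := Qq n; have [_ _ [v]] := FP _ Qn.
  rewrite qn /q iterS => -> [_ /= zv] [_ /= zv'] sn kn.
  have /eq_in_map : level_values n.+1 z = level_values n.+1 z' by rewrite zv zv'.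
  by apply; exact: mem_level_coords.
Qed.

(** Digit [k] of the label along [x] is fixed from stage [k.+1] on, so it depends only on the first
    [k.+1] digits of [x]. The edge condition holds at all finite stages after the edge appears,
    hence in the limit, as [W] is closed. *)
Lemma amalgam_limit (d : nat -> seq bool) :
  (forall n, size (d n) = n) -> large 0 setT ->
  exists h : (nat -> bool) -> nat -> nat,
    (forall x x' k, (forall i, (i <= k)%N -> x i = x' i) -> h x k = h x' k) /\
    forall n y, E (p (h (word_cat (rcons (d n) false) y)))
                  (p (h (word_cat (rcons (d n) true) y))).
Proof.
move=> dn l0; have [H [H0 HS Heq]] := amalgam_sequence dn l0.
have /choice[z zH] : forall n, exists z, H n z by move=> n; exact: H0.
(* Here [m] is the stage minus the length of the word: 0 for the labels of vertices, [n.+1] for the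
   witnesses of the edges at [d n]. *)
pose lim b m (x : nat -> bool) k := z (m + k.+1)%N (b, mkseq x k.+1, k).
have limP b m x k j z' : (k < j)%N -> H (m + j)%N z' ->
    z' (b, mkseq x j, k) = lim b m x k.
  elim: j z' => // j IH z'; rewrite ltnS leq_eqVlt => /orP[/eqP ->|kj] Hz'.
    by apply: (Heq (m + j.+1)%N) => //; rewrite ?size_mkseq addnS ltnS leq_addl.
  rewrite -(IH (half (x j) z') kj); first by rewrite /half /= mkseqS.
  by move: Hz'; rewrite addnS => /HS[+ _]; exact.
exists (lim false 0%N); split.
  move=> x x' k xx'; rewrite /lim; congr (z _ (_, _, _)).
  by apply/eq_in_map => i; rewrite mem_iota => /andP[_ ik]; exact: xx'.
move=> n y; apply/W_E; exists (lim true n.+1 y).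
apply: contrapT => /W_closed[l lP].
pose bnd (i : (nat + nat) + nat) : nat :=
  match i with inl (inl k) => k | inl (inr k) => k | inr k => k end.
pose j := (\max_(i <- l) bnd i).+1.
have jP (i : (nat + nat) + nat) : i \in l -> (bnd i < j)%N.
  by move=> il; rewrite ltnS; apply: leq_bigmax_seq.
(* The edge enters at stage [n.+1] with an empty suffix, and later stages inherit it through their
   halves. *)
have HW : forall j z', H (n.+1 + j)%N z' ->
  W (edge_code (rcons (d n) false ++ mkseq y j) (rcons (d n) true ++ mkseq y j)
       (mkseq y j) z').
  elim=> [|k IH] z' /=.
    by rewrite addn0 !cats0 => /HS[].
  rewrite addnS mkseqS -!rcons_cat => /HS[Hh _].
  exact: (IH (half (y k) z')).
have mkseq_y b : mkseq (word_cat (rcons (d n) b) y) (n.+1 + j) =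
    rcons (d n) b ++ mkseq y j.
  by rewrite -mkseq_word_cat size_rcons dn.
apply: lP (HW j _ (zH _)) => -[[k|k]|k] /jP /= kj; rewrite /component.
- rewrite -(limP false 0%N _ _ (n.+1 + j)%N (z (n.+1 + j)%N)) ?ltn_addl//.
  by rewrite mkseq_y.
- rewrite -(limP false 0%N _ _ (n.+1 + j)%N (z (n.+1 + j)%N)) ?ltn_addl//.
  by rewrite mkseq_y.
- by rewrite -(limP true n.+1 y k j (z (n.+1 + j)%N)).
Qed.

End Dichotomy.

Theorem G0_dichotomy (T : topologicalType) (E : T -> T -> Prop)
    (p : (nat -> nat) -> T) (d : nat -> seq bool) :
  open_separated T -> fin_continuous p -> (forall x, exists a, p a = x) ->
  analytic_graph E -> (forall x y, E x y -> E y x) ->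
  (forall n, size (d n) = n) ->
  sigma_independent E [set: T] \/
  exists h : (nat -> bool) -> nat -> nat,
    (forall x x' k, (forall i, (i <= k)%N -> x i = x' i) -> h x k = h x' k) /\
    forall n y, E (p (h (word_cat (rcons (d n) false) y)))
                  (p (h (word_cat (rcons (d n) true) y))).
Proof.
move=> sepT cp surjp aE symE dn.
have [?|nI] := pselect (sigma_independent E [set: T]); [by left|right].
have [W [cW WE]] := edge_witness cp aE.
apply: (amalgam_limit sepT cp surjp aE symE cW WE dn).
move=> A sA; apply: contrapT => /forallNP nz; apply: nI.
suff <- : A = setT by [].
rewrite -subTset => x _; have [a <-] := surjp x.
(* At stage 0 the empty word is the only vertex, and this configuration gives it the arbitrary label
   [p a]. *)
have := nz (fun j => a j.2).
by move=> /not_andP[/(_ I)//|/existsNP[s /not_implyP[_ /contrapT]]].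
Qed.

(** * Baire category in the Cantor space *)

Lemma cantor_openP (U : set cantor_space) :
  open U <-> forall x, U x ->
    exists n, forall x' : cantor_space, (forall i, (i < n)%N -> x i = x' i) -> U x'.
Proof.
split.
- move=> oU x Ux; apply: contrapT => /forallNP nU.
  have /choice[y yP] : forall n, exists y : cantor_space,
      (forall i, (i < n)%N -> x i = y i) /\ ~ U y.
    by move=> n; have /existsNP[y /not_implyP] := nU n; exists y.
  have yx : {ptws, y @ \oo --> x}.
    apply/pointwise_cvgP => i /=; apply: cvg_near_cst.
    exists i.+1 => // n /= ni; rewrite -(yP n).1//.
  have : nbhs x U by exact: open_nbhs_nbhs.
  move=> /yx [N _ /(_ N (leqnn N))] /=; exact: (yP N).2.
- move=> UP; rewrite openE => x /UP[n nP]; rewrite /interior.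
  have nb : nbhs x [set x' : cantor_space | forall i, (i < n)%N -> x i = x' i].
    elim: n {nP} => [|n IH].
      by apply: filterS (@filterT _ (nbhs x) _).
    have : nbhs x [set x' : cantor_space | x' n = x n].
      apply: (@proj_continuous nat (fun=> bool) n x [set x n]).
      exact: discrete_set1.
    apply: filterS2 IH => x' xx' xn i.
    by rewrite ltnS leq_eqVlt => /orP[/eqP ->|]; [rewrite xn|exact: xx'].
  by apply: filterS nb => x'; exact: nP.
Qed.

Definition dense_words (D : set (seq bool)) : Prop :=
  forall s, exists2 t, prefix s t & D t.

(** On the comeagre set of the points that meet every [D k], [A] agrees with the open set generated
    by the words in [V]. *)
Definition baire_property (A : set cantor_space) : Prop :=
  exists (V : set (seq bool)) (D : nat -> set (seq bool)),
    (forall k, dense_words (D k)) /\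
    forall x : cantor_space, (forall k, exists n, D k (mkseq x n)) ->
      (A x <-> exists n, V (mkseq x n)).

Lemma take_mkseq (T : Type) (x : nat -> T) m n : take m (mkseq x n) = mkseq x (minn m n).
Proof. by rewrite /mkseq -map_take take_iota. Qed.

Lemma dense_wordsT : dense_words setT.
Proof. by move=> s; exists s => //; exact: prefix_refl. Qed.

Lemma baire_property_sigma_algebra : sigma_algebra setT baire_property.
Proof.
split.
- exists set0, (fun=> setT); split; first by move=> _; exact: dense_wordsT.
  by move=> x _; split => [|[]].
- move=> A [V [D [dD AV]]]; rewrite setTD.
  (* [V'] consists of the words whose cylinder misses the open set of [V]. A generic point must
     decide between the two open sets, whence the extra dense set below. *)
  pose V' : set (seq bool) := [set s | forall (x : nat -> bool) n,
    mkseq x (size s) = s -> ~ V (mkseq x n)].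
  exists V', (fun k => if k is k'.+1 then D k' else
    V' `|` [set s | exists n, V (take n s)]); split.
    case=> [|k]; last exact: dD.
    move=> s; case: (pselect (V' s)) => [V's|].
      by exists s; [exact: prefix_refl|left].
    move=> /existsNP[x /existsNP[n /not_implyP[xs /contrapT Vx]]].
    exists (mkseq x (maxn n (size s))).
      rewrite -[X in prefix X _]xs prefixE size_mkseq take_mkseq.
      by rewrite (minn_idPl _)// leq_maxr.
    by right; exists n; rewrite take_mkseq (minn_idPl _)// leq_maxl.
  move=> x xD; have {}AV := AV x (fun k => xD k.+1).
  split => [nAx|[n Vn] /AV[m Vm]].
    have [n [Vn|[m Vm]]] := xD 0%N; first by exists n.
    by exfalso; apply/nAx/AV; rewrite take_mkseq in Vm; exists (minn m n).
  by apply: (Vn x m) Vm; rewrite size_mkseq.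
- move=> A /choice[V VP]; have /choice[D DP] := VP.
  exists (\bigcup_n V n), (fun m => if unpickle m is Some (n, k) then D n k else setT).
  split.
    move=> m; case: (unpickle m) => [[n k]|]; last exact: dense_wordsT.
    by case: (DP n).
  move=> x xD.
  have {}DP n : A n x <-> exists k, V n (mkseq x k).
    by apply: (DP n).2 => k; have := xD (pickle (n, k)); rewrite pickleK.
  split => [[n _ /DP[k Vk]]|[k [n _ Vk]]]; first by exists k, n.
  by exists n => //; apply/DP; exists k.
Qed.

Lemma baire_property_open (U : set cantor_space) : open U -> baire_property U.
Proof.
move=> /cantor_openP oU.
exists [set s | forall x : cantor_space, mkseq x (size s) = s -> U x], (fun=> setT).
split; first by move=> _; exact: dense_wordsT.
move=> x _; split => [/oU[n nP]|[n]]; last by apply; rewrite size_mkseq.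
exists n => x'; rewrite size_mkseq => /eq_in_map xx'; apply: nP => i ni.
by rewrite xx'// mem_iota.
Qed.

Lemma baire_property_borel (B : set cantor_space) :
  borel cantor_space B -> baire_property B.
Proof.
apply: smallest_sub; first exact: baire_property_sigma_algebra.
exact: baire_property_open.
Qed.

Lemma generic_point (D : nat -> set (seq bool)) :
  (forall k, dense_words (D k)) ->
  exists x : cantor_space, forall k, exists n, D k (mkseq x n).
Proof.
move=> dD.
have /choice[F FP] : forall q : nat * seq bool, exists t, prefix q.2 t /\ D q.1 t.
  by move=> q; have [t] := dD q.1 q.2; exists t.
(* The appended digit makes the words grow strictly, so that they determine an infinite point. *)
pose t := fix t n := if n is m.+1 then rcons (F (m, t m)) false else [::].
have tS n : prefix (t n) (F (n, t n)) by exact: (FP (n, t n)).1.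
have tS' n : prefix (t n) (t n.+1).
  by rewrite (prefix_trans (tS n))//= prefix_rcons.
have tle m n : (m <= n)%N -> prefix (t m) (t n).
  move=> /subnK <-; elim: (n - m)%N => [|j IH]; first exact: prefix_refl.
  exact: prefix_trans IH (tS' _).
have st n : (n <= size (t n))%N.
  elim: n => [//|n IH] /=; rewrite size_rcons ltnS (leq_trans IH)//.
  exact: size_prefix.
pose x n := nth false (t n.+1) n.
have xt n : mkseq x (size (t n)) = t n.
  apply: (@eq_from_nth _ false); first by rewrite size_mkseq.
  move=> i; rewrite size_mkseq => it; rewrite nth_mkseq// /x.
  have nth_prefix a b : prefix a b -> (i < size a)%N -> nth false a i = nth false b i.
    by move=> /prefixP[c ->] ia; rewrite nth_cat ia.
  have [ni|/ltnW ni] := leqP n i.+1; last exact: nth_prefix (tle _ _ ni) (st _).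
  by rewrite (nth_prefix _ _ (tle _ _ ni)).
exists x => k; exists (size (F (k, t k))).
have -> : mkseq x (size (F (k, t k))) = F (k, t k); last exact: (FP (k, t k)).2.
have := xt k.+1; rewrite /= size_rcons mkseqS => /rcons_inj[].
by [].
Qed.

(** Some [A n] contains all generic points through some word [mkseq x i]. Extend this word to a node
    [d] of [D2] and choose [z] so that [d0z] and [d1z] are both generic: they form an edge inside
    [A n]. *)
Lemma baire_cover_G0 (D2 : set (seq bool)) (A : nat -> set cantor_space) :
  dense_nodes D2 -> (forall n, baire_property (A n)) ->
  (forall x, exists n, A n x) ->
  exists n x y, [/\ A n x, A n y & G0 D2 x y].
Proof.
move=> dD2 /choice[V VP] covA; have /choice[D DP] := VP.
pose D' m := if unpickle m is Some (n, k) then D n k else setT.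
have dD' m : dense_words (D' m).
  rewrite /D'; case: (unpickle m) => [[n k]|]; last exact: dense_wordsT.
  by case: (DP n).
have D'P (x : cantor_space) n : (forall m, exists i, D' m (mkseq x i)) ->
    A n x <-> exists i, V n (mkseq x i).
  move=> xD; apply: (DP n).2 => k.
  by have := xD (pickle (n, k)); rewrite /D' pickleK.
have [x xD] := generic_point dD'.
have [n /D'P-/(_ xD)[i Vi]] := covA x.
have [d D2d id] := dD2 (mkseq x i).
(* These dense sets for [z] express genericity of both ends of the edge at once. *)
pose C m := if unpickle m is Some (b, k) then
  [set t | D' k (rcons d b ++ t)] else setT.
have dC m : dense_words (C m).
  rewrite /C; case: (unpickle m) => [[b k]|]; last exact: dense_wordsT.
  move=> s; have [t /prefixP[t' ->]] := dD' k (rcons d b ++ s).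
  by rewrite -catA; exists (s ++ t') => //; rewrite prefix_prefix.
have [z zC] := generic_point dC.
have zA b : A n (word_cat (rcons d b) z).
  apply/D'P.
    move=> k; have := zC (pickle (b, k)); rewrite /C pickleK => -[j Dj].
    by exists (size (rcons d b) + j)%N; rewrite mkseq_word_cat.
  exists i; have /prefixP[t dt] := id.
  have := mkseq_word_cat (rcons d b) z 0; rewrite addn0 cats0.
  move=> /(congr1 (take i)); rewrite take_mkseq (minn_idPl _); last first.
    by rewrite dt size_rcons size_cat size_mkseq ltnW// ltnS leq_addr.
  by move=> ->; rewrite dt rcons_cat take_size_cat ?size_mkseq.
exists n, (word_cat (rcons d false) z), (word_cat (rcons d true) z).
by split => //; exists d => //; exists z; left.
Qed.

(** * Polish spaces as images of the Baire space *)

Section Baire_image.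
Variables (R : realType) (M : metricType R) (d : nat -> M).
Hypothesis M_complete : forall F : set_system M,
  ProperFilter F -> cauchy F -> exists x : M, F --> x.
Hypothesis d_dense : forall (x : M) (e : R), (0 < e)%R ->
  exists n, (mdist (d n) x < e)%R.
Local Open Scope ring_scope.

(** A proposed point [d (a n)] is accepted only if it is close to the current one, which is
    otherwise repeated; thus every [a] yields a Cauchy sequence. *)
Fixpoint approx (a : nat -> nat) (n : nat) : M :=
  if n is m.+1 then
    if mdist (approx a m) (d (a n)) < 2^-1 ^+ m then d (a n) else approx a m
  else d (a 0%N).

Lemma approx_step a n : mdist (approx a n) (approx a n.+1) < 2^-1 ^+ n.
Proof. by rewrite /=; case: ifP => // _; rewrite mdistxx exprn_gt0// invr_gt0. Qed.

Lemma approx_dist a n j : mdist (approx a n) (approx a (n + j)) <= 2 * 2^-1 ^+ n.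
Proof.
(* The subtracted geometric tail is what makes the induction on [j] go through. *)
suff : mdist (approx a n) (approx a (n + j)) <= 2 * 2^-1 ^+ n - 2 * 2^-1 ^+ (n + j).
  have : 0 <= (2^-1 : R) ^+ (n + j) by rewrite exprn_ge0// invr_ge0.
  lra.
elim: j => [|j IH]; first by rewrite addn0 mdistxx subrr.
have := metric_triangle (approx a n) (approx a (n + j)) (approx a (n + j.+1)).
have := approx_step a (n + j); rewrite addnS exprS.
lra.
Qed.

Lemma approx_cauchy a : exists x : M, approx a @ \oo --> x.
Proof.
apply: M_complete; apply: cauchy_exP => e e0.
have [N _ NP] := near_infty_natSinv_expn_lt (PosNum (divr_gt0 e0 (ltr0n R 2))).
exists (approx a N); exists N => // n /= Nn.
rewrite ballEmdist /= -(subnKC Nn).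
apply: (le_lt_trans (approx_dist _ _ _)).
have /= := NP N (leqnn N); rewrite div1r -exprVn.
lra.
Qed.

Definition approx_lim a : M := projT1 (cid (approx_cauchy a)).

Lemma approx_lim_dist a n : mdist (approx a n) (approx_lim a) <= 2 * 2^-1 ^+ n.
Proof.
apply/ler_addgt0Pr => e e0.
have := projT2 (cid (approx_cauchy a)); rewrite -/(approx_lim a).
move=> /(_ (ball (approx_lim a) e))[|N _ NP]; first exact: nbhsx_ballx.
have := NP (n + N)%N (leq_addl _ _); rewrite /= ballEmdist /= metric_sym => lt_e.
have := approx_dist a n N.
have := metric_triangle (approx a n) (approx a (n + N)) (approx_lim a).
lra.
Qed.

Lemma approx_eq a a' n : (forall i, (i <= n)%N -> a i = a' i) ->
  approx a n = approx a' n.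
Proof.
elim: n => [|n IH] aa' /=; first by rewrite aa'.
by rewrite IH ?aa'// => i ni; rewrite aa'// leqW.
Qed.

Lemma small_pow (e : R) : 0 < e -> exists n, (2^-1 : R) ^+ n < e.
Proof.
move=> e0; have [N _ NP] := near_infty_natSinv_expn_lt (PosNum e0).
by exists N; have /= := NP N (leqnn N); rewrite div1r -exprVn.
Qed.

Lemma approx_lim_continuous : fin_continuous approx_lim.
Proof.
move=> a U oU Ua.
have [e /= e0 eU] : nbhs_ball (approx_lim a) U.
  by rewrite nbhs_ballE; exact: open_nbhs_nbhs.
(* Both limits are within [2 * 2^-1 ^+ n] of a common approximation, hence the 4. *)
have [n ne] := small_pow (divr_gt0 e0 (ltr0n R 4)).
exists (iota 0 n.+1) => a' aa'; apply: eU; rewrite ballEmdist /=.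
have E : approx a n = approx a' n.
  by apply: approx_eq => i ni; apply: aa'; rewrite mem_iota.
have := approx_lim_dist a n; rewrite E metric_sym.
have := approx_lim_dist a' n.
have := metric_triangle (approx_lim a) (approx a' n) (approx_lim a').
lra.
Qed.

Lemma approx_lim_surjective x : exists a, approx_lim a = x.
Proof.
have pow_gt0 n : 0 < (2^-1 : R) ^+ n by rewrite exprn_gt0// invr_gt0.
(* With this precision consecutive points differ by less than [3/4] of [2^-1 ^+ n], so every
   proposal is accepted. *)
have /choice[a aP] : forall n, exists k, mdist (d k) x < 2^-1 ^+ n / 2.
  by move=> n; apply: d_dense; rewrite divr_gt0.
have aE n : approx a n = d (a n).
  elim: n => //= n ->; rewrite ifT//.
  have := metric_triangle (d (a n)) x (d (a n.+1)).
  have := aP n; have := aP n.+1; rewrite exprS (metric_sym x).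
  have := pow_gt0 n; lra.
exists a; apply: mdist_positivity; apply/eqP; rewrite eq_le mdist_ge0 andbT.
apply/ler_addgt0Pr => e e0; rewrite add0r.
have [n ne] := small_pow (divr_gt0 e0 (ltr0n R 4)).
have := approx_lim_dist a n; rewrite aE.
have := metric_triangle (approx_lim a) (d (a n)) x.
rewrite (metric_sym (approx_lim a) (d _)).
have := aP n; have := pow_gt0 n.
lra.
Qed.

End Baire_image.

Lemma polish_Baire_image (T : topologicalType) (x0 : T) : polish T ->
  open_separated T /\ exists p : (nat -> nat) -> T,
    fin_continuous p /\ forall x, exists a, p a = x.
Proof.
move=> [[D cD dD] [R [M [h [[g hK gK] h_open M_complete]]]]].
have oh U : open U <-> open (g @^-1` U).
  rewrite h_open; have -> // : h @^-1` (g @^-1` U) = U.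
  by apply/seteqP; split => x /=; rewrite hK.
split.
  move=> x y xy; pose e : R := (mdist (h x) (h y) / 2)%R.
  have e0 : (0 < e)%R.
    by rewrite divr_gt0// mdist_gt0; apply: contra_notN xy => /eqP/(can_inj hK).
  exists (h @^-1` (ball (h x) e)^°), (h @^-1` (ball (h y) e)^°); split.
  - by apply/h_open; exact: open_interior.
  - by apply/h_open; exact: open_interior.
  - exact: nbhsx_ballx.
  - exact: nbhsx_ballx.
  - rewrite -subset0 => z /= [/interior_subset xz /interior_subset].
    move: xz; rewrite !ballEmdist /= => xz yz.
    have := metric_triangle (h x) (h z) (h y); rewrite (metric_sym (h z)).
    by rewrite /e in xz yz; lra.
have D0 : D !=set0.
  by have [||x [_ Dx]] := dD setT; [exists x0|exact: openT|exists x].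
have [f fP] : exists f : nat -> T, forall x, D x -> exists n, f n = x.
  have /pfcard_geP[D0'|[f]] := cD; first by case: D0 => x; rewrite D0'.
  by exists f => x /(@surj _ _ _ _ f)[n _ <-]; exists n.
have d_dense (x : M) (e : R) : (0 < e)%R -> exists n, (mdist (h (f n)) x < e)%R.
  move=> e0; have [||y [yx Dy]] := dD (h @^-1` (ball x e)^°).
  - by exists (g x); rewrite /= gK; exact: nbhsx_ballx.
  - by apply/h_open; exact: open_interior.
  - have [n fn] := fP _ Dy; exists n; rewrite fn metric_sym.
    by have := interior_subset yx; rewrite ballEmdist.
exists (fun a => g (approx_lim (h \o f) M_complete a)); split.
  move=> a U /oh oU Ua.
  exact: (@approx_lim_continuous R M (h \o f) M_complete a _ oU Ua).
move=> x; have [a ax] := approx_lim_surjective M_complete d_dense (h x).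
by exists a; rewrite ax hK.
Qed.

(** * Singletons in P(G0) *)

Lemma compatible_sym (X : choiceType) (le : rel X) x y :
  compatible le x y -> compatible le y x.
Proof. by move=> [z [zx zy]]; exists z. Qed.

Lemma compatible_centred_fset2 (X : choiceType) (le : rel X) x y :
  reflexive le -> transitive le ->
  compatible le x y <-> centred_fsets le [fset x; y]%fset.
Proof.
move=> le_refl le_trans; split => [[z [zx zy]] F Fxy|xy].
  by exists z => u /Fxy /=; rewrite !inE => /orP[]/eqP ->.
by have [z zP] := xy _ (fun u => id); exists z; split; apply: zP; rewrite !inE eqxx ?orbT.
Qed.

(** The map sending [z] to the pair [{g z, h z}] pulls each generator of [fset_borel] back to a
    union of the preimages of [B] under [g] and [h], hence the Borel set of centred sets back to a
    bianalytic set. *)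
Lemma incompatible_analytic (P : topologicalType) (le : rel P) :
  borel_poset le -> fset_borel P (centred_fsets le) ->
  analytic_graph (fun x y => ~ compatible le x y).
Proof.
move=> bP C_borel J g h cg ch.
pose pr z := [fset g z; h z]%fset.
have -> : [set z | ~ compatible le (g z) (h z)] = ~` (pr @^-1` centred_fsets le).
  have cE z := compatible_centred_fset2 (g z) (h z) (borel_poset_refl bP)
    (borel_poset_trans bP).
  by apply/seteqP; split => z /= nc; apply: contra_not nc => /cE.
suff [] : bianalytic (pr @^-1` centred_fsets le) by [].
have [b0 bC bU] := bianalytic_sigma_algebra J.
apply: sigma_generated_preimage C_borel; first exact: bianalytic_sigma_algebra.
move=> _ [B bB <-].
have -> : pr @^-1` [set F : {fset P} | exists2 x, x \in F & B x] =
    \bigcup_n (if n is 0%N then g @^-1` B else h @^-1` B).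
  apply/seteqP; split => z /=.
    move=> [x]; rewrite !inE => /orP[]/eqP -> Bx; first by exists 0%N.
    by exists 1%N.
  by move=> [[|n] _ /= Bz]; [exists (g z)|exists (h z)] => //; rewrite !inE eqxx ?orbT.
by apply: bU => -[|n]; exact: bianalytic_borel.
Qed.

Lemma G0_irreflexive (D2 : set (seq bool)) x : ~ G0 D2 x x.
Proof.
have neq d z : word_cat (rcons d false) z <> word_cat (rcons d true) z.
  move=> /(congr1 (fun x => x (size d))).
  by rewrite /word_cat !nth_rcons ltnn eqxx.
by move=> [d _ [z [[-> /neq]|[-> /esym/neq]]]].
Qed.

Section Singletons.
Variable D2 : set (seq bool).

Lemma G0_free_singleton x : [fset x]%fset \in G0_free D2.
Proof.
by rewrite inE => u v /fset1P -> /fset1P ->; exact: G0_irreflexive.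
Qed.

Definition singleton (x : cantor_space) : PG0 D2 := 
  exist (fun F => F \in G0_free D2) _ (G0_free_singleton x).

Definition singletons : set (PG0 D2) := range singleton.

Lemma singleton_incompatible x y :
  ~ compatible (PG0_le D2) (singleton x) (singleton y) ->
  G0 D2 x y \/ G0 D2 y x.
Proof.
move=> nxy; apply: contrapT => /not_orP[xy yx]; apply: nxy.
have xyP : [fset x; y]%fset \in G0_free D2.
  rewrite inE => u v.
  by move=> /fset2P[]-> /fset2P[]-> //; exact: G0_irreflexive.
by exists (exist (fun F => F \in G0_free D2) _ xyP); split;
  rewrite /PG0_le /=; [exact: fsubsetUl|exact: fsubsetUr].
Qed.

Lemma compatible_singleton x y :
  compatible (PG0_le D2) (singleton x) (singleton y) -> ~ G0 D2 x y.
Proof.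
move=> [F []]; rewrite /PG0_le /= !fsub1set.
exact: (set_mem (valP F)).
Qed.

(** Along the map from [x] to [{x}], a countable Borel linked cover would become a cover of the
    Cantor space by sets with the Baire property, one of which contains an edge. *)
Lemma singletons_not_sigma_linked : dense_nodes D2 ->
  ~ borel_sigma_linked (PG0_le D2) (PG0_borel D2) singletons.
Proof.
move=> dD2 [L [bL linkL covL]].
have /choice[S SP] : forall n, exists S, fset_borel cantor_space S /\
    forall x, S [fset x]%fset <-> L n (singleton x).
  move=> n; have [_ [S bS <-] <-] := bL n; exists S; split => // x.
  by split => [Sx|[[_ Sx] _]] //; split; [split|exists x].
have [|x|n [x [y [Sx Sy xy]]]] :=
    @baire_cover_G0 D2 (fun n => [set x | S n [fset x]%fset]) dD2.
- move=> n; apply: (sigma_generated_preimage (g := fun x => [fset x]%fset))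
    (SP n).1; first exact: baire_property_sigma_algebra.
  move=> _ [B bB <-].
  have -> : (fun x : cantor_space => [fset x]%fset) @^-1`
      [set F : {fset cantor_space} | exists2 x, x \in F & B x] = B.
    apply/seteqP; split => x /= => [[y /fset1P ->//]|Bx].
    by exists x => //; exact: fset11.
  exact: baire_property_borel.
- have : singletons (singleton x) by exists x.
  by rewrite -covL => -[n _ Lx]; exists n; apply/(SP n).2.
- by apply: compatible_singleton xy; apply: (linkL n); apply/(SP n).2.
Qed.

Definition singleton_point (p : singletons) : cantor_space :=
  s2val (cid2 (set_mem (valP p))).

Lemma singleton_pointK p : singleton (singleton_point p) = set_val p.
Proof. exact: s2valP' (cid2 (set_mem (valP p))). Qed.

(** The preimage of [B] consists of the singletons that meet [B], which is the trace of a generator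
    of [fset_borel]. *)
Lemma singleton_point_borel :
  borel_map (sub_borel (PG0_borel D2) singletons) (borel cantor_space)
            singleton_point.
Proof.
move=> B bB; pose S := [set F : {fset cantor_space} | exists2 x, x \in F & B x].
exists (set_val @^-1` S).
  exists S; last by rewrite setTI.
  by apply: sub_sigma_algebra; exists B.
rewrite setTI; apply/seteqP; split => p /=; rewrite -singleton_pointK /S /=.
  by move=> [x /fset1P ->].
by move=> Bp; exists (singleton_point p) => //; exact: fset11.
Qed.

End Singletons.

(** * Exclusivity of the two cases and the dichotomy for Borel posets *)

Lemma borel_sigma_linked_G0_exclusive (D2 : set (seq bool))
    (P : topologicalType) (le : rel P) (P' : set (PG0 D2)) (phi : P' -> P) :
  borel_map (sub_borel (PG0_borel D2) P') (borel P) phi ->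
  (forall p q : P', ~ compatible (PG0_le D2) (set_val p) (set_val q) ->
     ~ compatible le (phi p) (phi q)) ->
  borel_sigma_linked le (borel P) [set: P] ->
  borel_sigma_linked (PG0_le D2) (PG0_borel D2) P'.
Proof.
move=> bphi phiP [L [bL linkL covL]].
have /choice[S SP] : forall n, exists S, PG0_borel D2 S /\
    forall p : P', S (set_val p) <-> L n (phi p).
  move=> n; have [B bB BL] := bL n; have [S bS SB] := bphi _ bB.
  exists S; split => // p; rewrite -BL.
  have /seteqP[SBl SBr] := SB.
  by split => [Sp|[Bp _]]; [split => //; apply: SBl; split|case: (SBr _ Bp)].
exists (fun n => S n `&` P'); split.
- by move=> n; exists (S n) => //; case: (SP n).
- move=> n x y [Sx P'x] [Sy P'y].
  pose u : P' := exist (fun p => p \in P') x (mem_set P'x).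
  pose v : P' := exist (fun p => p \in P') y (mem_set P'y).
  apply: contrapT => /(phiP u v); apply; apply: (linkL n).
    exact/((SP n).2 u).
  exact/((SP n).2 v).
- apply/seteqP; split => [x [n _ []]//|x P'x].
  pose u : P' := exist (fun p => p \in P') x (mem_set P'x).
  have : [set: P] (phi u) by [].
  rewrite -covL => -[n _ Lu]; exists n => //; split => //.
  exact/((SP n).2 u).
Qed.

Theorem theorem7 (D2 : set (seq bool))
    (D2_dense : dense_nodes D2) (D2_length : one_node_per_length D2)
    (P : topologicalType) (le : rel P) (P_borel : borel_poset le)
    (C_borel : fset_borel P (centred_fsets le))
    (f : centred_fsets le -> P)
    (f_borel : borel_map (sub_borel (fset_borel P) (centred_fsets le))
                         (borel P) f)
    (f_le : forall (C : centred_fsets le) (p : P),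
              p \in set_val C -> le (f C) p) :
  let linked_case := borel_sigma_linked le (borel P) [set: P] in
  let G0_case :=
    exists (P' : set (PG0 D2)) (phi : P' -> P),
      [/\ ~ borel_sigma_linked (PG0_le D2) (PG0_borel D2) P',
          borel_map (sub_borel (PG0_borel D2) P') (borel P) phi &
          forall p q : P',
            ~ compatible (PG0_le D2) (set_val p) (set_val q) ->
            ~ compatible le (phi p) (phi q)] in
  (linked_case \/ G0_case) /\ ~ (linked_case /\ G0_case).
Proof.
move=> linked_case G0_case; split; last first.
  move=> [lP [P' [phi [nP' bphi phiP]]]]; apply: nP'.
  exact: borel_sigma_linked_G0_exclusive bphi phiP lP.
(* The parametrization by the Baire space requires a point; an empty [P] is covered by empty linked
   sets. *)
have [P0|/existsNP[x0 _]] := pselect (forall x : P, False).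
  left; exists (fun=> set0); split => //.
  - by move=> _; exists set0; [exact: sigma_algebra0|rewrite set0I].
  - by move=> _ x; case: (P0 x).
  - by apply/seteqP; split => x; case: (P0 x).
have [sepP [p [cp surjp]]] := polish_Baire_image x0 (borel_poset_polish P_borel).
have /choice[d dP] : forall n, exists d, D2 d /\ size d = n.
  by move=> n; have [d [dn _]] := D2_length n; exists d.
have dE s : D2 s -> s = d (size s).
  move=> Ds; have [t [_ tP]] := D2_length (size s).
  by rewrite -[LHS](tP s)// -[RHS](tP _ (dP _)).
have [||[B [BP BT]]|[h [h_cont hE]]] := G0_dichotomy (d := d) sepP cp surjp
    (incompatible_analytic P_borel C_borel).
- by move=> x y; apply: contra_not; exact: compatible_sym.
- by move=> n; case: (dP n).
- left; exists B; split => //.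
  + by move=> n; exists (B n); [case: (BP n)|rewrite setIT].
  + by move=> n x y Bx By; apply: contrapT; case: (BP n) => _; exact.
right; exists (@singletons D2), (fun q => p (h (@singleton_point D2 q))); split.
- exact: singletons_not_sigma_linked.
- move=> B bB; apply: (@singleton_point_borel D2 ((p \o h) @^-1` B)).
  apply: sigma_generated_preimage bB; first exact: smallest_sigma_algebra.
  move=> U oU; apply: sub_sigma_algebra; apply/cantor_openP => x Ux.
  (* Continuity of [p] at [h x] involves finitely many digits [k] of [h x], each determined by the
     digits of [x] up to [k]. *)
  have [l lP] := cp _ _ oU Ux; exists (\max_(k <- l) k).+1 => x' xx'.
  apply: lP => k kl; apply: h_cont => i ik; apply: xx'.
  by rewrite ltnS (leq_trans ik)//; apply: leq_bigmax_seq.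
- have hG0 x y : G0 D2 x y -> ~ compatible le (p (h x)) (p (h y)).
    move=> [s /dE -> [z [[-> ->]|[-> ->]]]]; first exact: hE.
    by move=> /compatible_sym; exact: hE.
  move=> q q'; rewrite -!singleton_pointK => /singleton_incompatible[/hG0//|/hG0].
  by apply: contra_not; exact: compatible_sym.
Qed.
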